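(* Let $(H,\circ)$ be a $\le$-hypergroupoid. If $R$ is a right ideal of $H$, then the characteristic function $f_R$ is a fuzzy right ideal of $H$. Conversely, if $R$ is a nonempty subset of $H$ such that $f_R$ is a fuzzy right ideal of $H$, then $R$ is a right ideal of $H$.
   Context: Let ${\cal P}^*(H)$ denote the set of nonempty subsets of $H$. A hypergroupoid $(H,\circ)$ is a nonempty set $H$ with a hyperoperation $\circ : H\times H\to {\cal P}^*(H)$, $(a,b)\mapsto a\circ b$. It induces an operation $*$ on ${\cal P}^*(H)$ by $A*B=\bigcup_{(a,b)\in A\times B}(a\circ b)$. No associativity is assumed. A $\le$-hypergroupoid is a hypergroupoid $H$ endowed with an arbitrary binary relation denoted $\le$ (not necessarily an order, and not assumed compatible with $\circ$); $b\ge a$ means $a\le b$. A nonempty subset $A$ of a $\le$-hypergroupoid $H$ is a right ideal of $H$ if (1) $A*H\subseteq A$ and (2) if $a\in A$, $b\in H$ and $b\le a$, then $b\in A$. A fuzzy subset of $H$ is any mapping $f:H\to[0,1]$. A fuzzy subset $f$ of $H$ is a fuzzy right ideal of $H$ if (1) $x\le y$ implies $f(x)\ge f(y)$ for all $x,y\in H$, and (2) for all $x,y\in H$ and all $u\in x\circ y$, $f(u)\ge f(x)$. For $A\subseteq H$, the characteristic function $f_A:H\to\{0,1\}\subseteq[0,1]$ is given by $f_A(x)=1$ if $x\in A$ and $f_A(x)=0$ if $x\notin A$. *)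

(* Defs.v *)
From mathcomp Require Import all_boot all_order all_algebra.
From mathcomp Require Import boolp classical_sets functions reals interval_inference numfun.

Set Implicit Arguments.
Unset Strict Implicit.
Unset Printing Implicit Defensive.

Import Order.TTheory GRing.Theory Num.Theory.
Local Open Scope classical_set_scope.
Local Open Scope ring_scope.

(* A map into the nonempty subsets is a set-valued map with nonempty values. *)
Record hypergroupoid := Hypergroupoid {
  hcarrier :> Type;
  hop : hcarrier -> hcarrier -> set hcarrier;
  hcarrier_nonempty : [set: hcarrier] !=set0;
  hop_nonempty : forall a b, hop a b !=set0
}.

Definition hmul (H : hypergroupoid) (A B : set H) : set H :=
  \bigcup_(p in A `*` B) hop p.1 p.2.

Lemma hmul_nonempty (H : hypergroupoid) (A B : set H) :
  A !=set0 -> B !=set0 -> hmul A B !=set0.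
Proof.
move=> [a Aa] [b Bb]; have [u abu] := hop_nonempty a b.
by exists u, (a, b).
Qed.

(* The relation is arbitrary: neither an order nor compatible with [hop]. *)
Record le_hypergroupoid := LeHypergroupoid {
  lh_hypergroupoid :> hypergroupoid;
  lh_le : lh_hypergroupoid -> lh_hypergroupoid -> Prop
}.

Definition right_ideal (H : le_hypergroupoid) (A : set H) : Prop :=
  [/\ A !=set0,
      hmul A [set: H] `<=` A
    & forall a b : H, A a -> lh_le b a -> A b].

(* [{i01 K}] is the closed interval [0, 1] of K with the induced order. *)
Definition fuzzy_subset (K : realType) (H : Type) := H -> {i01 K}.

Definition fuzzy_right_ideal (K : realType) (H : le_hypergroupoid)
    (f : fuzzy_subset K H) : Prop :=
  (forall x y : H, lh_le x y -> f x >= f y) /\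
  (forall x y u : H, hop x y u -> f u >= f x).

Definition characteristic (K : realType) (H : Type) (A : set H) :
    fuzzy_subset K H :=
  fun x => if x \in A then 1%:i01 else 0%:i01.

Lemma characteristicE (K : realType) (H : Type) (A : set H) (x : H) :
  (characteristic K A x)%:num = \1_A x :> K.
Proof. by rewrite /characteristic indicE; case: (x \in A). Qed.

(* Main.v *)
Require Import Defs.
From mathcomp Require Import all_boot all_order all_algebra.
From mathcomp Require Import boolp classical_sets functions reals interval_inference numfun.

(** A characteristic function takes only the values 0 < 1, so an inequality
    between two of its values is an implication between memberships
    ([le_characteristic]).  Read through this equivalence, the two conditions
    on a fuzzy right ideal say that [R] is closed downwards and that [x \in R]
    forces [hop x y] into [R] for every [y]; the latter is the pointwise form
    of [hmul R setT `<=` R] ([hmul_setT_subP]). *)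

Local Open Scope classical_set_scope.

Lemma le_characteristic (K : realType) (T : Type) (A : set T) (x y : T) :
  (characteristic K A x <= characteristic K A y)%R <-> (A x -> A y).
Proof.
rewrite -num_le !characteristicE !indicE Num.Theory.ler_nat.
split=> [le_xy /mem_set Ax | Axy].
  by apply: set_mem; move: le_xy; rewrite Ax; case: (y \in A).
by case: (boolP (x \in A)) => // /set_mem /Axy /mem_set ->.
Qed.

Lemma hmul_setT_subP (H : hypergroupoid) (A : set H) :
  hmul A [set: H] `<=` A <-> (forall x y u, hop x y u -> A x -> A u).
Proof.
split=> [AH x y u xyu Ax | AH u [[x y] [/= Ax _] xyu]].
  by apply: AH; exists (x, y).
exact: AH xyu Ax.
Qed.

Theorem proposition7 (K : realType) (H : le_hypergroupoid) :
  (forall R : set H,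
      right_ideal R -> fuzzy_right_ideal (characteristic K R)) /\
  (forall R : set H,
      R !=set0 -> fuzzy_right_ideal (characteristic K R) -> right_ideal R).
Proof.
split=> R.
  case=> _ /hmul_setT_subP RH Rdown; split=> [x y le_xy | x y u xyu].
    by apply/le_characteristic => Ry; exact: Rdown Ry le_xy.
  by apply/le_characteristic; exact: RH xyu.
move=> R0 [Rdown RH]; split=> //.
  by apply/hmul_setT_subP => x y u /RH /le_characteristic.
by move=> a b Ra /Rdown /le_characteristic; exact.
Qed.
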